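(* There is an absolute constant $C>0$ such that every Cayley graph on $n\ge 2$ vertices has an orthonormal eigenbasis (of its adjacency matrix) consisting of real-valued functions $x$ with $\|x\|_{L^2}=1$ and $\|x\|_{L^\infty}\le C\sqrt{\log n}$.
   Context: A Cayley graph on a finite group $G$ with symmetric generating set $S=S^{-1}$ not containing the identity has vertex set $G$ and edges $\{g,sg\}$, $g\in G$, $s\in S$. Functions on the vertex set are $x\colon G\to\mathbb{R}$, with normalized norms $\|x\|_{L^2}=(\mathbb{E}_{g\in G}|x(g)|^2)^{1/2}$, $\|x\|_{L^\infty}=\max_g |x(g)|$; orthonormality is with respect to the inner product $\langle x,y\rangle=\mathbb{E}_{g\in G}\overline{x(g)}y(g)$. A set of functions is called $C$-bounded if each has $L^\infty$ norm at most $C$. *)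

(* Defs.v *)
From HB Require Import structures.
From mathcomp Require Import all_boot all_order all_algebra all_fingroup.
From mathcomp Require Import reals exp.

Set Implicit Arguments.
Unset Strict Implicit.
Unset Printing Implicit Defensive.

Import Order.TTheory GRing.Theory Num.Theory.
Local Open Scope ring_scope.

Definition cayley_edges (gT : finGroupType) (S : {set gT}) : {set {set gT}} :=
  [set [set g; (s * g)%g] | g in [set: gT], s in S].

(* Rows and columns are indexed by T through its canonical enumeration. *)
Definition adjacency_mx (R : realType) (T : finType) (E : {set {set T}}) :
    'M[R]_#|T| :=
  \matrix_(i, j) ([set enum_val i; enum_val j] \in E)%:R.

(* The codomain is R^o, rather than R, so that {ffun T -> R^o} carries the
   library's structure of finite-dimensional vector space over R. *)
Section FunctionsOnVertices.
Variables (R : realType) (T : finType).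
Implicit Types (x y : {ffun T -> R^o}) (B : seq {ffun T -> R^o}).

Definition expect (f : T -> R) : R := #|T|%:R^-1 * \sum_g f g.

Definition L2dot x y : R := expect (fun g => x g * y g).

Definition L2norm x : R := Num.sqrt (expect (fun g => `|x g| ^+ 2)).

Definition Linfnorm x : R := \big[Num.max/0]_g `|x g|.

Definition orthonormal_fun B : Prop :=
  forall i j : 'I_(size B), L2dot B`_i B`_j = (i == j)%:R.

Definition col_of_fun x : 'cV[R]_#|T| := \col_i x (enum_val i).

Definition eigenfunction (A : 'M[R]_#|T|) x : Prop :=
  x != 0 /\ exists a : R, A *m col_of_fun x = a *: col_of_fun x.

Definition orthonormal_eigenbasis (A : 'M[R]_#|T|) B : Prop :=
  [/\ basis_of fullv B, orthonormal_fun B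
    & forall x, x \in B -> eigenfunction A x].

End FunctionsOnVertices.

(* Main.v *)
Require Import Defs.
From HB Require Import structures.
From mathcomp Require Import all_boot all_order all_algebra all_fingroup.
From mathcomp Require Import reals exp.
From mathcomp Require Import complex spectral.
From mathcomp Require Import sequences trigo.
From mathcomp Require Import ring lra.

Set Implicit Arguments.
Unset Strict Implicit.
Unset Printing Implicit Defensive.

Import Order.TTheory GRing.Theory Num.Theory.
Local Open Scope ring_scope.

(** The adjacency matrix is real symmetric and invariant under right
translations. Diagonalize it by an orthogonal matrix [Q], whose rows are
eigenvectors. The orthogonal projector on an eigenspace of dimension [m] is
invariant under translations, so its diagonal is constant, equal to [m / n]:
the squares of the values at any vertex of the rows of [Q] spanning this
eigenspace sum to [m / n].

Within each eigenspace, multiply these rows by signs and then apply an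
orthogonal matrix with entries [O(1 / sqrt m)] (the discrete Hartley transform).
Every value of every new eigenvector is then a signed sum with coefficients
of square sum at most [2 / n]. By a Chernoff bound, performed greedily
one sign at a time, some choice of signs makes all these [n ^ 2] sums
[O(sqrt (ln n / n))], which is the claim after normalization by [sqrt n]. *)

(** * The real spectral theorem *)

Lemma mul_row_trE (R : pzRingType) n (u v : 'rV[R]_n) :
  (u *m v^T) 0 0 = \sum_i u 0 i * v 0 i.
Proof. by rewrite mxE; apply: eq_bigr => i _; rewrite mxE. Qed.

Lemma sqr_row_ge0 (R : realDomainType) n (u : 'rV[R]_n) : 0 <= (u *m u^T) 0 0.
Proof. by rewrite mul_row_trE; apply: sumr_ge0 => i _; rewrite -expr2 sqr_ge0. Qed.

Lemma sqr_row_eq0 (R : realDomainType) n (u : 'rV[R]_n) :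
  ((u *m u^T) 0 0 == 0) = (u == 0).
Proof.
apply/idP/eqP => [|->]; last by rewrite mul0mx mxE.
rewrite mul_row_trE psumr_eq0 => [/allP u0|i _]; last by rewrite -expr2 sqr_ge0.
apply/rowP => i; rewrite mxE; apply/eqP; rewrite -sqrf_eq0 expr2.
by have := u0 i; rewrite mem_index_enum => /(_ isT).
Qed.

(** A complex eigenvector [u + i w] always exists. Computing [u A w^T] in two ways, by symmetry of
    [A], gives [Im z (|u|^2 + |w|^2) = 0]; so [z] is real, and whichever of [u], [w] is nonzero is a
    real eigenvector. *)
Lemma sym_mx_eigenvector (R : rcfType) n (A : 'M[R]_n) :
  (0 < n)%N -> A^T = A ->
  exists a, exists2 v : 'rV[R]_n, v *m A = a *: v & v != 0.
Proof.
move=> n_gt0 symA.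
pose AC := map_mx (real_complex R) A.
have [z /eigenvalueP[v vA v0]] := eigenvalue_closed AC n_gt0.
pose u := map_mx (@complex.Re R) v; pose w := map_mx (@complex.Im R) v.
have ReD (x y : R[i]) : complex.Re (x + y) = complex.Re x + complex.Re y by case: x y => [? ?] [? ?].
have ImD (x y : R[i]) : complex.Im (x + y) = complex.Im x + complex.Im y by case: x y => [? ?] [? ?].
have ReM (x y : R[i]) : complex.Re (x * y) = complex.Re x * complex.Re y - complex.Im x * complex.Im y.
  by case: x y => [? ?] [? ?].
have ImM (x y : R[i]) : complex.Im (x * y) = complex.Re x * complex.Im y + complex.Im x * complex.Re y.
  by case: x y => [? ?] [? ?] /=; ring.
have uA : u *m A = complex.Re z *: u - complex.Im z *: w.
  apply/rowP => j; have /rowP/(_ j)/(congr1 (@complex.Re R)) := vA.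
  rewrite !mxE ReM (big_morph _ ReD (erefl : complex.Re 0 = 0)) => <-.
  by apply: eq_bigr => i _; rewrite !mxE ReM /= mulr0 subr0.
have wA : w *m A = complex.Re z *: w + complex.Im z *: u.
  apply/rowP => j; have /rowP/(_ j)/(congr1 (@complex.Im R)) := vA.
  rewrite !mxE ImM (big_morph _ ImD (erefl : complex.Im 0 = 0)) => <-.
  by apply: eq_bigr => i _; rewrite !mxE ImM /= mulr0 add0r.
have uw0 : (u != 0) || (w != 0).
  rewrite -negb_and; apply: contra v0 => /andP[/eqP u0 /eqP w0].
  apply/eqP/rowP => j; move/rowP/(_ j): u0; move/rowP/(_ j): w0.
  by rewrite !mxE; case: (v 0 j) => a b /= -> ->.
have zR : complex.Im z = 0.
  have : u *m A *m w^T = u *m (w *m A)^T by rewrite trmx_mul symA mulmxA.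
  rewrite uA wA mulmxBl [(_ + _)^T]linearD /= mulmxDr ![(_ *: _)^T]linearZ /= -!scalemxAl -!scalemxAr.
  move/addrI => e; have /eqP : complex.Im z *: (u *m u^T + w *m w^T) = 0.
    by rewrite scalerDr -e addNr.
  rewrite scaler_eq0 => /orP[/eqP//|/eqP/matrixP/(_ 0 0)/eqP].
  rewrite [X in X == _]mxE [X in _ == X]mxE.
  by rewrite paddr_eq0 ?sqr_row_ge0// !sqr_row_eq0 -[_ && _]negbK negb_and uw0.
exists (complex.Re z); move: uA wA; rewrite zR !scale0r subr0 addr0 => uA wA.
by case/orP: uw0 => ?; [exists u | exists w].
Qed.

Lemma sym_mx_unit_eigenvector (R : rcfType) n (A : 'M[R]_n) :
  (0 < n)%N -> A^T = A ->
  exists a, exists2 v : 'rV[R]_n, v *m A = a *: v & v *m v^T = 1%:M.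
Proof.
move=> n_gt0 /(sym_mx_eigenvector n_gt0)[a [v vA v0]].
set c := Num.sqrt ((v *m v^T) 0 0).
have c2 : c ^+ 2 = (v *m v^T) 0 0 by rewrite sqr_sqrtr ?sqr_row_ge0.
have c0 : c != 0 by rewrite -sqrf_eq0 c2 sqr_row_eq0.
exists a; exists (c^-1 *: v); first by rewrite -scalemxAl vA !scalerA mulrC.
rewrite [_^T]linearZ /= -scalemxAl -scalemxAr scalerA [v *m _]mx11_scalar -c2.
rewrite -mul_scalar_mx -scalar_mxM; congr (_%:M); field.
exact: c0.
Qed.

(* The Householder reflection exchanging the two unit vectors [e] and [v]. *)
Lemma exists_reflection (R : realFieldType) n (e v : 'rV[R]_n) :
  e *m e^T = 1%:M -> v *m v^T = 1%:M ->
  exists2 H : 'M[R]_n, H *m H^T = 1%:M & e *m H = v.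
Proof.
move=> e1 v1; have [->|ev] := eqVneq e v.
  by exists 1%:M; rewrite ?trmx1 mulmx1.
pose w := e - v; set c := (w *m w^T) 0 0.
have c0 : c != 0 by rewrite sqr_row_eq0 subr_eq0.
have ww : w *m w^T = c%:M by rewrite -mx11_scalar.
set k := 2 / c; set T := w^T *m w.
have TT : T *m T = c *: T.
  by rewrite mulmxA -[_ *m w *m _]mulmxA ww mul_mx_scalar -scalemxAl.
have symT : T^T = T by rewrite trmx_mul trmxK.
have ve : v *m e^T = e *m v^T.
  by apply/matrixP => i j; rewrite !ord1 !mul_row_trE; apply: eq_bigr => l _; rewrite mulrC.
(* As [e] and [v] are unit vectors, [|e - v|^2 = 2 <e, e - v>]; hence the reflection takes [e] to
   [e - w = v]. *)
have cE : c = 2 * (e *m w^T) 0 0.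
  suff -> : c = (e *m w^T + e *m w^T) 0 0 by rewrite mxE mulr2n mulrDl mul1r.
  rewrite /c {1}/w mulmxBl /w ![(_ - _)^T]linearB /= !mulmxBr e1 v1 ve.
  by rewrite opprB.
have ew : k *: (e *m w^T) = 1%:M.
  rewrite [e *m _]mx11_scalar scale_scalar_mx; congr (_%:M).
  by rewrite mulrAC -cE divff.
exists (1%:M - k *: T).
  rewrite [_^T]linearB /= [(_ *: _)^T]linearZ /= trmx1 symT mulmxBl mul1mx mulmxBr mulmx1.
  rewrite -scalemxAl -scalemxAr TT !scalerA.
  have -> : k * k * c = k + k by rewrite /k; field; exact: c0.
  by rewrite scalerDl -[X in _ - X = _]opprB addrK opprK subrK.
by rewrite mulmxBr mulmx1 -scalemxAr mulmxA scalemxAl ew mul1mx opprB addrC subrK.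
Qed.

(** Induction on the size. A reflection [H] sends the first basis vector to a unit eigenvector, so
    the first row of [H A H^T] vanishes off the diagonal. By symmetry so does its first column, and
    a smaller symmetric block remains. *)
Theorem real_spectral_theorem (R : rcfType) n (A : 'M[R]_n) : A^T = A ->
  exists P : 'M[R]_n, exists2 d : 'rV[R]_n,
    P *m P^T = 1%:M & A = P^T *m diag_mx d *m P.
Proof.
elim: n A => [|n IHn].
  by move=> A _; exists 1%:M; exists 0; apply/matrixP => -[].
rewrite -[n.+1]/(1 + n)%N => A symA.
have [a [v vA v1]] := sym_mx_unit_eigenvector (ltn0Sn n) symA.
pose e : 'rV[R]_(1 + n) := delta_mx 0 0.
have e1 : e *m e^T = 1%:M.
  by rewrite trmx_delta mul_delta_mx; apply/matrixP => i j; rewrite !ord1 !mxE.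
have [H HHt eH] := exists_reflection e1 v1.
have HtH := mulmx1C HHt.
have [B BE0] : exists B : 'M_(1 + n), B = H *m A *m H^T by eexists.
have symB : B^T = B by rewrite BE0 !trmx_mul trmxK symA mulmxA.
have eB : e *m B = a *: e.
  by rewrite BE0 !mulmxA eH vA -scalemxAl -eH -mulmxA HHt mulmx1.
have B0 j : B 0 j = a * (j == 0)%:R.
  by move/rowP/(_ j): eB; rewrite -rowE !mxE => ->.
have [P' [d' P1 dE]] := IHn (drsubmx B) ltac:(by rewrite trmx_drsub symB).
have BE : B = block_mx a%:M 0 0 (drsubmx B).
  have l0 : lshift n (0 : 'I_1) = 0 by apply: val_inj.
  rewrite -[LHS]submxK; congr block_mx; apply/matrixP => i j; rewrite !mxE !ord1 l0.
  - by rewrite B0 mulr1.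
  - by rewrite B0 mulr0.
  - by rewrite -symB mxE B0 mulr0.
exists (block_mx 1%:M 0 0 P' *m H); exists (row_mx a%:M d').
  rewrite trmx_mul mulmxA -[_ *m H *m _]mulmxA HHt mulmx1.
  rewrite tr_block_mx mulmx_block !trmx0 trmx1 !(mulmx0, mul0mx, mulmx1) P1.
  by rewrite !(addr0, add0r) -scalar_mx_block.
rewrite trmx_mul -mulmxA (mulmxA _ _ H) -(mulmxA H^T) (mulmxA _ _ H) .
rewrite diag_mx_row tr_block_mx !mulmx_block !trmx0 trmx1.
rewrite !(mulmx0, mul0mx, mulmx1, mul1mx, addr0, add0r) !mulmxA -dE.
have -> : diag_mx a%:M = a%:M by apply/matrixP => i j; rewrite !mxE !ord1.
by rewrite -BE BE0 !mulmxA HtH mul1mx -mulmxA HtH mulmx1.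
Qed.

(** * The Hartley transform *)

Section TrigonometricSums.
Variables (R : realType) (d : nat) (t : R).
Hypothesis td : cos (t *+ d) = 1.

Let c := \sum_(j < d) cos (t *+ j).
Let s := \sum_(j < d) sin (t *+ j).

(* Rotating by [t] permutes the summands, hence the vector [(c, s)] is fixed by
   a rotation of angle [t]. *)
Let rotate_sums : c * cos t - s * sin t = c /\ s * cos t + c * sin t = s.
Proof.
have st : sin (t *+ d) = 0 by apply: cos1sin0; rewrite td normr1.
have shift (f : R -> R) : f (t *+ d) = f 0 ->
    \sum_(j < d) f (t *+ j.+1) = \sum_(j < d) f (t *+ j).
  move=> fd; apply: (@addrI _ (f (t *+ 0))).
  by rewrite -(big_ord_recl d (fun j => f (t *+ j))) big_ord_recr /= fd mulr0n addrC.
split.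
- transitivity (\sum_(j < d) cos (t *+ j.+1)); last by apply: shift; rewrite td cos0.
  rewrite !mulr_suml -sumrB.
  by apply: eq_bigr => j _; rewrite mulrSr cosD.
- transitivity (\sum_(j < d) sin (t *+ j.+1)); last by apply: shift; rewrite st sin0.
  rewrite !mulr_suml -big_split /=.
  by apply: eq_bigr => j _; rewrite mulrSr sinD.
Qed.

Let sums_eq0 : cos t != 1 -> c = 0 /\ s = 0.
Proof.
have [e1 e2] := rotate_sums; rewrite -subr_eq0 => t1.
(* Pair [(c, s)] with its rotated image, which is [(c, s)] again. *)
have /eqP : (cos t - 1) * (c ^+ 2 + s ^+ 2) = 0.
  transitivity (c * (c * cos t - s * sin t - c) + s * (s * cos t + c * sin t - s)).
    by ring.
  by rewrite e1 e2; ring.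
rewrite mulf_eq0 (negPf t1) paddr_eq0 ?sqr_ge0// !sqrf_eq0 => /andP[/eqP ? /eqP ?].
by split.
Qed.

Lemma sum_cos_eq0 : cos t != 1 -> \sum_(j < d) cos (t *+ j) = 0.
Proof. by case/sums_eq0. Qed.

(** When [cos t = 1], where the rotation argument says nothing, every single term is zero. *)
Lemma sum_sin_eq0 : \sum_(j < d) sin (t *+ j) = 0.
Proof.
have [t1|/sums_eq0[]//] := eqVneq (cos t) 1.
have s0 : sin t = 0 by apply: cos1sin0; rewrite t1 normr1.
have H j : cos (t *+ j) = 1 /\ sin (t *+ j) = 0.
  elim: j => [|j [cj sj]]; first by rewrite mulr0n cos0 sin0.
  by rewrite mulrSr cosD sinD cj sj t1 s0; split; ring.
by apply: big1 => j _; rewrite (H j).2.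
Qed.

End TrigonometricSums.

(* The discrete Hartley transform: a real orthogonal matrix of each size [d]
   all of whose entries are [O(1 / sqrt d)]. *)
Definition hartley (R : realType) (d i j : nat) : R :=
  let x := pi *+ 2 * i%:R / d%:R *+ j in (cos x + sin x) / Num.sqrt d%:R.

Section Hartley.
Variable R : realType.

Lemma hartley_sqr_le d i j : (hartley R d i j) ^+ 2 <= 2 / d%:R.
Proof.
rewrite /hartley; set x := _ *+ j.
rewrite expr_div_n sqr_sqrtr ?ler0n// ler_wpM2r ?invr_ge0 ?ler0n//.
have := cos2Dsin2 x; have := sqr_ge0 (cos x - sin x); nra.
Qed.

(** With [cas = cos + sin], one has [cas a * cas b = cos (a - b) + sin (a + b)]. The sines always
    sum to zero, and the cosines do unless [i = k]. *)
Lemma hartley_orthogonal d (i k : nat) : (i < d)%N -> (k < d)%N ->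
  \sum_(j < d) hartley R d i j * hartley R d k j = (i == k)%:R.
Proof.
wlog ki : i k / (k <= i)%N.
  move=> W; case/orP: (leq_total k i) => [/W//|/W Wik id kd].
  by rewrite eq_sym -Wik//; apply: eq_bigr => j _; rewrite mulrC.
move=> id kd; have d_gt0 : (0 < d)%N := leq_ltn_trans (leq0n _) id.
have d0 : d%:R != 0 :> R by rewrite pnatr_eq0 -lt0n (leq_ltn_trans _ id).
have dgt0 : 0 < d%:R :> R by rewrite lt_def d0 ler0n.
pose t m : R := pi *+ 2 * m%:R / d%:R.
have td m : cos (t m *+ d) = 1.
  rewrite /t -[_ *+ d]mulr_natr divfK // mulr_natr -[_ *+ m]add0r.
  by rewrite (periodicn (@cosD2pi R)) cos0.
have tD : t (i + k)%N = t i + t k by rewrite /t natrD; ring.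
have tB : t (i - k)%N = t i - t k by rewrite /t natrB //; ring.
have E j : hartley R d i j * hartley R d k j =
    (cos (t (i - k)%N *+ j) + sin (t (i + k)%N *+ j)) / d%:R.
  rewrite /hartley -/(t i) -/(t k) tD tB mulrnBl mulrnDl sinD cosB mulf_div -expr2.
  by rewrite sqr_sqrtr ?ler0n//; congr (_ / _); ring.
under eq_bigr do rewrite E.
rewrite -mulr_suml big_split /= sum_sin_eq0 // addr0.
have [<-|ik] := eqVneq i k.
  rewrite subnn /t mulr0 mul0r.
  under eq_bigr do rewrite mul0rn cos0.
  by rewrite sumr_const card_ord divff.
rewrite sum_cos_eq0 ?mul0r //.
have ik0 : (0 < i - k)%N by rewrite subn_gt0 ltn_neqAle eq_sym ik.
set m := (i - k)%N in ik0 *.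
have md : (m < d)%N by rewrite (leq_ltn_trans (leq_subr _ _)).
(* The half angle lies strictly between [0] and [pi] because [0 < m < d], so its sine is positive
   and [cos (t m) < 1]. *)
have -> : t m = (pi * m%:R / d%:R) *+ 2 by rewrite /t !mulr2n; ring.
have : 0 < sin (pi * m%:R / d%:R : R).
  apply: sin_gt0_pi; rewrite divr_gt0 ?mulr_gt0 ?pi_gt0 ?ltr0n //=.
  by rewrite ltr_pdivrMr // ltr_pM2l ?pi_gt0 // ltr_nat.
rewrite cos_mulr2n; have := cos2Dsin2 (pi * m%:R / d%:R : R).
set x := sin _; set y := cos _ => e x0; apply/eqP; rewrite mulr2n; nra.
Qed.

End Hartley.

(** * Balancing signs *)
Section Signs.
Variable R : realType.

(** The constant 2 in the exponent allows an elementary proof. For [x > 1/2], both [x] and [- x] are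
    at most [2 x^2]. For [0 <= x <= 1/2], the bounds [e^x (1 - x) <= 1] and [e^(-x) (1 + x) <= 1]
    give [(e^x + e^(-x)) (1 - x^2) <= 2], and [1 <= (1 - x^2) (1 + 2 x^2)]. *)
Lemma expR_sum_le (x : R) : expR x + expR (- x) <= 2 * expR (2 * x ^+ 2).
Proof.
wlog x0 : x / 0 <= x.
  move=> W; case: (leP 0 x) => [/W//|/ltW xn].
  by have := W (- x); rewrite oppr_ge0 => /(_ xn); rewrite opprK sqrrN addrC.
have [xl|xg] := leP x (1/2); last first.
  rewrite mulr2n mulrDl mul1r lerD // ler_expR; nra.
have e1 := expR_ge1Dx (2 * x ^+ 2).
have e2 := expR_ge1Dx (- x).
have e3 := expR_ge1Dx x.
have e4 : expR x * expR (- x) = 1 by rewrite expRN divff // gt_eqF ?expR_gt0.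
have p1 := expR_gt0 x; have p2 := expR_gt0 (- x).
have b1 : expR x * (1 - x) <= 1 by nra.
have b2 : expR (- x) * (1 + x) <= 1 by nra.
have : (expR x + expR (- x)) * (1 - x ^+ 2) <= 2 by nra.
nra.
Qed.

Definition sgn (b : bool) : R := if b then 1 else -1.

(* Signs are chosen one at a time: for one of the two choices, the exponential
   moment grows by at most its average, a product of hyperbolic cosines. *)
Lemma exists_signs_expR (I : finType) (J : eqType) (r : seq J) (a : I -> J -> R) :
  uniq r ->
  exists e : J -> bool,
    \sum_i (expR (\sum_(j <- r) sgn (e j) * a i j)
            + expR (- \sum_(j <- r) sgn (e j) * a i j))
    <= \sum_i 2 * expR (2 * \sum_(j <- r) a i j ^+ 2).
Proof.
(* The offset [w] holds the partial sums already fixed by earlier signs, so that the induction goes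
   through. *)
suff H : forall w : I -> R, uniq r ->
  exists e : J -> bool,
    \sum_i (expR (w i + \sum_(j <- r) sgn (e j) * a i j)
            + expR (- (w i + \sum_(j <- r) sgn (e j) * a i j)))
    <= \sum_i (expR (w i) + expR (- w i)) * expR (2 * \sum_(j <- r) a i j ^+ 2).
  move=> /(H (fun=> 0))[e He]; exists e; move: He.
  under eq_bigr do rewrite add0r.
  by under [X in _ <= X]eq_bigr do rewrite oppr0 expR0.
elim: r => [|j r IHr] w.
  move=> _; exists xpredT; apply: ler_sum => i _.
  by rewrite !big_nil addr0 mulr0 expR0 mulr1.
move=> /= /andP[jr ur].
pose Phi b := \sum_i (expR (w i + sgn b * a i j) + expR (- (w i + sgn b * a i j)))
   * expR (2 * \sum_(j <- r) a i j ^+ 2).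
pose M := \sum_i (expR (w i) + expR (- w i)) *
   expR (2 * \sum_(j <- j :: r) a i j ^+ 2).
have PhiM : Phi true + Phi false <= 2 * M.
  rewrite /Phi /M mulr_sumr -big_split /=; apply: ler_sum => i _.
  rewrite big_cons mulrDr expRD /sgn mul1r mulN1r !opprD opprK !expRD.
  have := expR_sum_le (a i j).
  set u := expR (a i j); set u' := expR (- _); set v := expR (2 * a i j ^+ 2) => uv.
  have := expR_gt0 (2 * \sum_(j0 <- r) a i j0 ^+ 2); set z := expR _ => z0.
  have := expR_gt0 (w i); have := expR_gt0 (- w i).
  set x := expR (w i); set x' := expR (- w i) => x'0 x0.
  rewrite -subr_ge0.
  have -> : 2 * ((x + x') * (v * z)) -
    ((x * u + x' * u') * z + (x * u' + x' * u) * z)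
    = (2 * v - (u + u')) * ((x + x') * z) by ring.
  by rewrite mulr_ge0 ?subr_ge0 // mulr_ge0 ?addr_ge0 // ltW.
have [b Hb] : exists b, Phi b <= M.
  case: (leP (Phi true) M) => [?|ltM]; first by exists true.
  by exists false; lra.
have [e He] := IHr (fun i => w i + sgn b * a i j) ur.
exists (fun k => if k == j then b else e k).
apply: le_trans (le_trans He Hb).
rewrite le_eqVlt; apply/orP; left; apply/eqP; apply: eq_bigr => i _; rewrite !big_cons eqxx addrA.
suff -> : \sum_(k <- r) sgn (if k == j then b else e k) * a i k =
  \sum_(k <- r) sgn (e k) * a i k by [].
rewrite big_seq [RHS]big_seq; apply: eq_bigr => k kr.
by case: eqP => // kj; rewrite kj (negPf jr) in kr.
Qed.

(** Each [exp (t |x|)] is at most [exp (t x) + exp (- t x)], a single term of the total exponential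
    moment; take logarithms. The parameter [t] stays free, to be optimized later. *)
Lemma exists_signs_bound (I : finType) (J : finType) (a : I -> J -> R) (v t : R) :
  (forall i, \sum_j a i j ^+ 2 <= v) -> 0 <= t -> (0 < #|I|)%N ->
  exists e : J -> bool,
    forall i, t * `|\sum_j sgn (e j) * a i j| <= ln (2 * #|I|%:R) + 2 * t ^+ 2 * v.
Proof.
move=> av t0 I0.
have [e He] := exists_signs_expR (fun i j => t * a i j) (index_enum_uniq J).
exists e => i.
have [N NE] : exists N : R, N = 2 * #|I|%:R by eexists.
rewrite -NE; have N0 : 0 < N by rewrite NE mulr_gt0 // ltr0n.
have sE k : \sum_j sgn (e j) * (t * a k j) = t * \sum_j sgn (e j) * a k j.
  by rewrite mulr_sumr; apply: eq_bigr => j _; ring.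
have : expR (t * `|\sum_j sgn (e j) * a i j|) <= N * expR (2 * t ^+ 2 * v).
  apply: (le_trans _ (le_trans He _)).
  - rewrite (bigD1 i) //= sE; set x := \sum_j _.
    apply: (@le_trans _ _ (expR (t * x) + expR (- (t * x)))).
      by case: (ger0P x) => _; rewrite ?mulrN ?lerDl ?lerDr expR_ge0.
    by rewrite lerDl sumr_ge0 // => k _; rewrite addr_ge0 ?expR_ge0.
  - apply: (@le_trans _ _ (\sum_(k : I) 2 * expR (2 * t ^+ 2 * v))).
      apply: ler_sum => k _; rewrite ler_pM2l // ler_expR.
      rewrite -mulrA ler_pM2l //.
      under eq_bigr do rewrite exprMn.
      by rewrite -mulr_sumr ler_wpM2l ?sqr_ge0.
    by rewrite sumr_const -[_ *+ _]mulr_natr NE mulrAC mulrA.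
rewrite -ler_ln ?posrE ?mulr_gt0 ?expR_gt0 //.
by rewrite lnM ?posrE ?expR_gt0 // !expRK.
Qed.

End Signs.

(** * Flat eigenbases of transitive matrices *)

(** Transfers the orthogonality of Hartley rows, indexed by ranks, to an eigenspace given as a set
    of indices. *)
Lemma sum_index_enum (V : nmodType) (I : finType) (K : {set I}) (f : nat -> V) :
  \sum_(l in K) f (index l (enum K)) = \sum_(j < #|K|) f j.
Proof.
rewrite -big_enum; case E : (enum K) => [|x r].
  by move: (cardE K); rewrite E big_nil => ->; rewrite big_ord0.
rewrite -E (big_nth x) -cardE big_mkord; apply: eq_bigr => j _.
by rewrite index_uniq ?enum_uniq // -cardE.
Qed.

Lemma perm_mx_comm (R : pzRingType) n (A : 'M[R]_n) (s : 'S_n) :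
  perm_mx s *m A = A *m perm_mx s <-> (forall k l, A (s k) (s l) = A k l).
Proof.
have E k l : (A *m perm_mx s) k (s l) = A k l.
  by rewrite -[s]invgK -col_permE !mxE invgK permK.
rewrite -row_permE; split=> [sA k l|sA]; first by rewrite -[RHS]E -sA mxE.
by apply/matrixP => k l; rewrite -[l](permKV s) E mxE sA.
Qed.

(** Commuting with [diag_mx d] forces [M k l = 0] unless [d 0 k = d 0 l]. Taking for [f] the
    indicator of one eigenvalue yields commutation with a spectral projector. *)
Lemma diag_mx_comm (R : idomainType) n (M : 'M[R]_n) (d : 'rV[R]_n) (f : R -> R) :
  diag_mx d *m M = M *m diag_mx d ->
  diag_mx (map_mx f d) *m M = M *m diag_mx (map_mx f d).
Proof.
move=> dM; apply/matrixP => k l; move/matrixP/(_ k l): dM.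
rewrite !mul_diag_mx !mul_mx_diag !mxE => /eqP.
rewrite mulrC -subr_eq0 -mulrBr mulf_eq0 subr_eq0.
by case/orP=> /eqP ->; rewrite ?mul0r ?mulr0 // mulrC.
Qed.

Section TransitiveMatrix.
Variables (R : realType) (n : nat) (A : 'M[R]_n).
Hypothesis transA : forall i j, exists2 s : 'S_n,
  s i = j & forall k l, A (s k) (s l) = A k l.

Section Eigenspaces.
Variables (Q : 'M[R]_n) (d : 'rV[R]_n).
Hypotheses (QQt : Q *m Q^T = 1%:M) (AE : A = Q^T *m diag_mx d *m Q).

Let eigenset (x : R) : {set 'I_n} := [set l | d 0 l == x].

(* The sum is the [i]-th diagonal entry of the orthogonal projector on the
   eigenspace of [x]; this projector is invariant under the symmetries of [A],
   so its diagonal is constant, while its trace is the dimension. *)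
Lemma eigenspace_mass x i :
  n%:R * \sum_(l in eigenset x) Q l i ^+ 2 = #|eigenset x|%:R.
Proof.
pose F i := \sum_(l in eigenset x) Q l i ^+ 2.
have QtQ := mulmx1C QQt.
pose D' := diag_mx (map_mx (fun y => (y == x)%:R : R) d).
pose E := Q^T *m D' *m Q.
have EF j : E j j = F j.
  rewrite /E -mulmxA mul_diag_mx mxE [RHS]big_mkcond /=.
  apply: eq_bigr => l _; rewrite !mxE inE.
  by case: eqP => _; rewrite ?mul1r ?mul0r ?mulr0 // expr2.
have Fs (s : 'S_n) j : (forall k l, A (s k) (s l) = A k l) -> F (s j) = F j.
  move=> /perm_mx_comm sA; rewrite -!EF; suff /perm_mx_comm -> : perm_mx s *m E = E *m perm_mx s by [].
  pose M := Q *m perm_mx s *m Q^T.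
  have DM : diag_mx d *m M = M *m diag_mx d.
    have DE : diag_mx d = Q *m A *m Q^T.
      by rewrite AE !mulmxA QQt mul1mx -mulmxA QQt mulmx1.
    rewrite DE /M !mulmxA -[_ *m Q^T *m Q]mulmxA QtQ mulmx1.
    by rewrite -[_ *m Q^T *m Q]mulmxA QtQ mulmx1 -(mulmxA Q A) -(mulmxA Q _ A) sA.
  have {}DM := diag_mx_comm (fun y => (y == x)%:R : R) DM.
  transitivity (Q^T *m (M *m D') *m Q).
    by rewrite /M /E !mulmxA QtQ mul1mx.
  by rewrite -DM /M /E !mulmxA -(mulmxA _ Q^T Q) QtQ mulmx1.
have Fc j : F j = F i by have [s <- /Fs] := transA i j.
(* The trace of the projector: each of the selected unit rows of [Q] contributes 1. *)
have -> : n%:R * F i = \sum_j F j.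
  by under eq_bigr do rewrite Fc; rewrite sumr_const card_ord mulr_natl.
rewrite exchange_big /= -sum1_card natr_sum; apply: eq_bigr => l _.
move/matrixP/(_ l l): QQt; rewrite !mxE eqxx /= => <-.
by apply: eq_bigr => j _; rewrite mxE expr2.
Qed.

Let rk (l : 'I_n) := index l (enum (eigenset (d 0 l))).
(** Block-diagonal up to reordering, with one Hartley matrix per eigenvalue: rows of [Q] are
    combined only within an eigenspace. *)
Let mix k l : R := if d 0 k == d 0 l
  then hartley R #|eigenset (d 0 k)| (rk k) (rk l) else 0.

Let mix_orthogonal k k' : \sum_l mix k l * mix k' l = (k == k')%:R.
Proof.
have mem j : j \in eigenset (d 0 j) by rewrite inE.
have rk_lt j : (rk j < #|eigenset (d 0%R j)|)%N by rewrite cardE index_mem mem_enum.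
have [dk|dk] := eqVneq (d 0 k) (d 0 k'); last first.
  have -> : (k == k') = false by apply: contraNF dk => /eqP ->.
  apply: big1 => l _; rewrite /mix; case: (eqVneq (d 0 k)) => [<-|]; last by rewrite mul0r.
  by rewrite eq_sym (negPf dk) mulr0.
have -> : (k == k') = (rk k == rk k').
  apply/eqP/eqP => [->//|]; rewrite /rk -dk => /(congr1 (nth k (enum (eigenset (d 0 k))))).
  by rewrite !nth_index ?mem_enum // dk.
rewrite -(@hartley_orthogonal R #|eigenset (d 0 k)|) ?rk_lt //; last by rewrite dk rk_lt.
rewrite -(sum_index_enum (eigenset (d 0 k)) (fun j => hartley R _ (rk k) j * hartley R _ (rk k') j)).
rewrite [RHS]big_mkcond /=; apply: eq_bigr => l _; rewrite /mix -dk inE eq_sym.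
by case: eqP => [dl|_]; rewrite ?mul0r // /rk dl.
Qed.

(** In an eigenspace of dimension [m], squared Hartley entries are at most [2 / m], while [n] times
    the mass at [i] is [m]. *)
Let mix_mass k i : \sum_l (Num.sqrt n%:R * (mix k l * Q l i)) ^+ 2 <= 2.
Proof.
set K := eigenset (d 0 k).
have K0 : 0 < #|K|%:R :> R.
  by rewrite ltr0n; apply/card_gt0P; exists k; rewrite inE.
apply: (@le_trans _ _ (2 / #|K|%:R * (n%:R * \sum_(l in K) Q l i ^+ 2))).
  rewrite !mulr_sumr [leRHS]big_mkcond /=; apply: ler_sum => l _.
  rewrite exprMn sqr_sqrtr ?ler0n // exprMn /mix inE eq_sym.
  case: eqP => _; last by rewrite expr0n /= !mul0r mulr0.
  rewrite mulrCA; apply: ler_wpM2r; last exact: hartley_sqr_le.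
  by rewrite mulr_ge0 ?ler0n ?sqr_ge0.
by rewrite eigenspace_mass divfK // gt_eqF.
Qed.

Lemma flat_eigenbasis_mixing : (1 < n)%N ->
  exists Y : 'M[R]_n, [/\ Y *m Y^T = 1%:M, Y *m A = diag_mx d *m Y &
    forall k i, Num.sqrt n%:R * `|Y k i| <= 7 * Num.sqrt (ln n%:R)].
Proof.
move=> n_gt1.
have ln2 : ln 2 <= ln n%:R :> R by rewrite ler_ln ?posrE ?ltr0n ?ler_nat // ltnW.
have ln0 : 0 < ln n%:R :> R by rewrite ln_gt0 // ltr1n.
have t0 : 0 < Num.sqrt (ln n%:R) :> R by rewrite sqrtr_gt0.
(* One choice of signs serves all [n^2] pairs [(k, i)], with [v = 2] and [t = sqrt (ln n)]. *)
have [|e He] := @exists_signs_bound R ('I_n * 'I_n)%type 'I_n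
   (fun p l => Num.sqrt n%:R * (mix p.1 l * Q l p.2)) _ _ (fun p => mix_mass p.1 p.2) (ltW t0).
  by rewrite card_prod card_ord muln_gt0 (ltnW n_gt1).
pose U := \matrix_(k, l) (mix k l * sgn R (e l)).
have sgn2 b : sgn R b * sgn R b = 1 by case: b; rewrite /sgn ?mulrNN mulr1.
exists (U *m Q); split.
- rewrite trmx_mul mulmxA -(mulmxA U) QQt mulmx1; apply/matrixP => k k'.
  rewrite !mxE -mix_orthogonal; apply: eq_bigr => l _.
  by rewrite !mxE mulrACA sgn2 mulr1.
(* It remains to see that [U] commutes with [diag_mx d], which holds as [mix] vanishes between
   distinct eigenvalues. *)
- rewrite AE !mulmxA -(mulmxA U) QQt mulmx1; congr (_ *m Q).
  apply/matrixP => k l; rewrite mul_diag_mx mul_mx_diag !mxE /mix.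
  by case: eqP => [->|_]; rewrite ?mul0r ?mulr0 // mulrC.
- move=> k i; rewrite -(ler_pM2l t0).
  have := He (k, i) => /=.
  have -> : \sum_l sgn R (e l) * (Num.sqrt n%:R * (mix k l * Q l i)) =
      Num.sqrt n%:R * (U *m Q) k i.
    by rewrite mxE mulr_sumr; apply: eq_bigr => l _; rewrite mxE; ring.
  rewrite normrM (ger0_norm (sqrtr_ge0 _)) => /le_trans; apply.
  rewrite [leRHS]mulrCA -expr2 (sqr_sqrtr (ltW ln0)) card_prod card_ord natrM.
  have n0 : 0 < n%:R :> R by rewrite ltr0n ltnW.
  (* Source of the constant 7: [ln (2 n^2) + 4 ln n <= 7 ln n], since [ln 2 <= ln n]. *)
  rewrite !lnM ?posrE ?mulr_gt0 //; lra.
Qed.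

End Eigenspaces.

Lemma transitive_flat_eigenbasis : A^T = A -> (1 < n)%N ->
  exists Y : 'M[R]_n, exists2 d : 'rV[R]_n,
    Y *m Y^T = 1%:M /\ Y *m A = diag_mx d *m Y &
    forall k i, Num.sqrt n%:R * `|Y k i| <= 7 * Num.sqrt (ln n%:R).
Proof.
move=> /real_spectral_theorem[Q [d QQt AE]] /(flat_eigenbasis_mixing QQt AE)[Y [? ? ?]].
by exists Y; exists d.
Qed.

End TransitiveMatrix.

(** * Cayley graphs *)

Section Eigenbasis.
Variables (R : realType) (T : finType).
Hypothesis T0 : (0 < #|T|)%N.
Implicit Types (x y : {ffun T -> R^o}) (B : seq {ffun T -> R^o}).

Let nT := #|T|%:R : R.
Let nT0 : 0 < nT. Proof. by rewrite ltr0n. Qed.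

Lemma L2dot_suml (I : finType) (c : I -> R) (X : I -> {ffun T -> R^o}) y :
  L2dot (\sum_i c i *: X i) y = \sum_i c i * L2dot (X i) y.
Proof.
rewrite /L2dot /expect; under [RHS]eq_bigr do rewrite mulrCA mulr_sumr.
rewrite -mulr_sumr exchange_big /=; congr (_ * _); apply: eq_bigr => g _.
by rewrite sum_ffunE mulr_suml; apply: eq_bigr => i _; rewrite ffunE mulrA.
Qed.

Lemma orthonormal_free B : orthonormal_fun B -> free B.
Proof.
move=> oB; have := in_tupleE B => <-; apply/freeP => k k0 i.
have := L2dot_suml k (fun j => B`_j) B`_i; rewrite k0.
rewrite (bigD1 i) //= big1 => [|j ji].
  rewrite oB eqxx mulr1 addr0 => <-; rewrite /L2dot /expect big1 ?mulr0 // => g _.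
  by rewrite ffunE mul0r.
by rewrite oB (negPf ji) mulr0.
Qed.

Lemma orthonormal_basis B : orthonormal_fun B -> size B = #|T| -> basis_of fullv B.
Proof.
move=> oB sB; rewrite basisEfree orthonormal_free // subvf dimvf sB.
by rewrite /dim /= muln1.
Qed.

Lemma L2norm_dot x : L2norm x = Num.sqrt (L2dot x x).
Proof.
by congr (Num.sqrt (_ * _)); apply: eq_bigr => g _; rewrite -normrX ger0_norm ?sqr_ge0.
Qed.

Lemma Linfnorm_le x (c : R) : 0 <= c -> (forall g, `|x g| <= c) -> Linfnorm x <= c.
Proof.
by move=> c0 xc; rewrite /Linfnorm; elim/big_ind: _ => // u v uc vc; rewrite ge_max uc.
Qed.

(** The factor [sqrt n] turns Euclidean orthonormality of rows into orthonormality for the averaged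
    inner product. *)
Definition fun_of_row (Y : 'M[R]_#|T|) k : {ffun T -> R^o} :=
  [ffun g => Num.sqrt nT * Y k (enum_rank g)].

Lemma L2dot_fun_of_row Y k l :
  L2dot (fun_of_row Y k) (fun_of_row Y l) = (Y *m Y^T) k l.
Proof.
rewrite /L2dot /expect mxE (reindex_onto (@enum_val T predT) (@enum_rank T)) /=; last first.
  by move=> g _; rewrite enum_rankK.
rewrite mulr_sumr; apply: eq_big => [i|i _]; first by rewrite enum_valK eqxx.
rewrite !ffunE enum_valK mxE mulrACA -expr2 (sqr_sqrtr (ltW nT0)).
by rewrite mulKf // gt_eqF.
Qed.

Lemma col_of_fun_of_row Y k : col_of_fun (fun_of_row Y k) = Num.sqrt nT *: (row k Y)^T.
Proof. by apply/colP => i; rewrite !mxE ffunE enum_valK. Qed.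

Lemma orthonormal_eigenbasis_of_rows (A Y : 'M[R]_#|T|) (d : 'rV[R]_#|T|) :
  A^T = A -> Y *m Y^T = 1%:M -> Y *m A = diag_mx d *m Y ->
  orthonormal_eigenbasis A [seq fun_of_row Y k | k <- enum 'I_#|T|].
Proof.
move=> symA YYt YA; set B := map _ _.
have sB : size B = #|T| by rewrite size_map size_enum_ord.
have BE (i : 'I_(size B)) : B`_i = fun_of_row Y (cast_ord sB i).
  have iT : (i < #|T|)%N by rewrite -sB.
  rewrite (nth_map (cast_ord sB i)) ?size_enum_ord //; congr fun_of_row.
  by apply: val_inj; rewrite /= nth_enum_ord.
have oB : orthonormal_fun B.
  by move=> i j; rewrite !BE L2dot_fun_of_row YYt mxE (inj_eq (@cast_ord_inj _ _ _)).
split=> //; first exact: orthonormal_basis.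
move=> _ /mapP[k _ ->]; split.
  apply/eqP => k0; have := L2dot_fun_of_row Y k k; rewrite YYt mxE eqxx k0.
  rewrite /L2dot /expect big1 => [/eqP|g _]; last by rewrite ffunE mul0r.
  by rewrite mulr0 eq_sym oner_eq0.
(* Rows of [Y] are left eigenvectors; transposing and using the symmetry of [A] makes them column
   eigenvectors. *)
exists (d 0 k); rewrite col_of_fun_of_row -scalemxAr scalerA mulrC -scalerA.
congr (_ *: _); apply: trmx_inj; rewrite trmx_mul symA linearZ /= !trmxK -row_mul YA.
by apply/rowP => j; rewrite mul_diag_mx !mxE.
Qed.

End Eigenbasis.

Lemma adjacency_mx_sym (R : realType) (T : finType) (E : {set {set T}}) :
  (adjacency_mx R E)^T = adjacency_mx R E.
Proof. by apply/matrixP => i j; rewrite !mxE setUC. Qed.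

Section Cayley.
Variables (gT : finGroupType) (S : {set gT}).

(** Generators act on the left, so right translations preserve edges by associativity. *)
Lemma cayley_edges_rmul g h x :
  [set g; h] \in cayley_edges S -> [set (g * x)%g; (h * x)%g] \in cayley_edges S.
Proof.
case/imset2P => a s _ sS E; apply/imset2P; exists (a * x)%g s; rewrite ?inE //.
have /(congr1 (fun A : {set gT} => [set (y * x)%g | y in A])) := E.
by rewrite !imsetU !imset_set1 mulgA.
Qed.

(** The permutation is right translation by [g^-1 h], where [g] and [h] are the vertices numbered
    [i] and [j]. *)
Lemma cayley_transitive (R : realType) (i j : 'I_#|gT|) : exists2 s : 'S_#|gT|,
  s i = j & forall k l, adjacency_mx R (cayley_edges S) (s k) (s l)
                        = adjacency_mx R (cayley_edges S) k l.
Proof.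
pose x := ((enum_val i)^-1 * enum_val j)%g.
pose f (k : 'I_#|gT|) := enum_rank (enum_val k * x)%g.
have f_inj : injective f.
  by move=> k l /enum_rank_inj/mulIg/enum_val_inj.
exists (perm f_inj); first by rewrite permE /f mulKVg enum_valK.
move=> k l; rewrite !permE !mxE !enum_rankK; congr (_%:R); congr nat_of_bool.
apply/idP/idP => [/cayley_edges_rmul -/(_ x^-1)%g|]; last exact: cayley_edges_rmul.
by rewrite !mulgK.
Qed.

End Cayley.

Theorem theorem1p3 (R : realType) :
  exists C : R, 0 < C /\
    forall (gT : finGroupType) (S : {set gT}),
      (S^-1)%g = S -> 1%g \notin S -> <<S>>%g = [set: gT] ->
      (2 <= #|gT|)%N ->
      exists B : seq {ffun gT -> R^o},
        orthonormal_eigenbasis (adjacency_mx R (cayley_edges S)) B /\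
        forall x, x \in B ->
          L2norm x = 1 /\ Linfnorm x <= C * Num.sqrt (ln (#|gT|%:R : R)).
Proof.
exists 7; split=> // gT S _ _ _ n_gt1.
have symA := adjacency_mx_sym R (cayley_edges S).
have [Y [d [YYt YA] Yb]] := transitive_flat_eigenbasis (@cayley_transitive gT S R) symA n_gt1.
exists [seq fun_of_row Y k | k <- enum 'I_#|gT|]; split.
  exact: orthonormal_eigenbasis_of_rows (ltnW n_gt1) _ _ _ symA YYt YA.
move=> _ /mapP[k _ ->]; split.
  by rewrite L2norm_dot L2dot_fun_of_row ?(ltnW n_gt1) // YYt mxE eqxx sqrtr1.
apply: Linfnorm_le => [|g]; first by rewrite mulr_ge0 ?sqrtr_ge0.
by rewrite ffunE normrM (ger0_norm (sqrtr_ge0 _)).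
Qed.
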